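(* Suppose the weighted composition operators $C_{\phi_1,\omega_1}$ and $C_{\phi_2,\omega_2}$ in $L^2(\mu)$ are densely defined. Then the sum $C_{\phi_1,\omega_1}C_{\phi_1,\omega_1}^*+C_{\phi_2,\omega_2}C_{\phi_2,\omega_2}^*$ is densely defined.
   Context: $(X,\mathscr{A},\mu)$ is a $\sigma$-finite measure space and $L^2(\mu)$ is the complex Hilbert space. For an $\mathscr{A}$-measurable transformation $\phi:X\to X$ and an $\mathscr{A}$-measurable $\omega:X\to\mathbb{C}$, put $\mu_\omega(\Delta)=\int_\Delta|\omega|^2d\mu$. The weighted composition operator $C_{\phi,\omega}$ in $L^2(\mu)$ has domain $\{f\in L^2(\mu):\omega\cdot(f\circ\phi)\in L^2(\mu)\}$ and acts by $C_{\phi,\omega}f=\omega\cdot(f\circ\phi)$. It is always assumed that $\mu_\omega\circ\phi^{-1}\ll\mu$ (so $C_{\phi,\omega}$ is well-defined). Sums and products of unbounded operators carry their natural domains. *)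

(* Defs.v *)
From HB Require Import structures.
From mathcomp Require Import all_boot all_order all_algebra.
From mathcomp Require Import all_classical all_reals all_analysis.
From mathcomp Require Import measurable_realfun ring_quotient complex.

Set Implicit Arguments.
Unset Strict Implicit.
Unset Printing Implicit Defensive.
Import Order.TTheory GRing.Theory Num.Theory.
Import complex ComplexField.Normc.
Import numFieldNormedType.Exports.

Local Open Scope classical_set_scope.
Local Open Scope complex_scope.
Local Open Scope ring_scope.

(* Measurability with respect to the Borel sigma-algebra of R[i], which the   *)
(* library does not equip with a measurable structure.                        *)
Definition measurable_cfun d (X : measurableType d) (R : realType)
    (f : X -> R[i]) : Prop :=
  measurable_fun [set: X] (fun x => Re (f x)) /\
  measurable_fun [set: X] (fun x => Im (f x)).

Lemma normc_ge0 (R : rcfType) (z : R[i]) : 0 <= normc z.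
Proof. by case: z => x y; exact: sqrtr_ge0. Qed.

Section measurable_cfun_theory.
Context d (X : measurableType d) (R : realType).
Implicit Types f g : X -> R[i].

Lemma measurable_cfun0 : measurable_cfun (0 : X -> R[i]).
Proof. by split; exact: measurable_cst. Qed.

Lemma measurable_cfunD f g :
  measurable_cfun f -> measurable_cfun g -> measurable_cfun (f + g).
Proof.
move=> [f1 f2] [g1 g2]; split.
- apply: eq_measurable_fun (measurable_funD f1 g1) => x _ /=.
  by rewrite fctE; case: (f x) (g x) => [? ?] [? ?].
- apply: eq_measurable_fun (measurable_funD f2 g2) => x _ /=.
  by rewrite fctE; case: (f x) (g x) => [? ?] [? ?].
Qed.

Lemma measurable_cfunM f g : measurable_cfun f -> measurable_cfun g ->
  measurable_cfun (fun x => f x * g x).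
Proof.
move=> [f1 f2] [g1 g2]; split.
- apply: eq_measurable_fun (measurable_funB (measurable_funM f1 g1)
    (measurable_funM f2 g2)) => x _ /=.
  by case: (f x) (g x) => [? ?] [? ?].
- apply: eq_measurable_fun (measurable_funD (measurable_funM f1 g2)
    (measurable_funM f2 g1)) => x _ /=.
  by case: (f x) (g x) => [? ?] [? ?].
Qed.

Lemma measurable_normc f :
  measurable_cfun f -> measurable_fun [set: X] (fun x => normc (f x)).
Proof.
move=> [f1 f2].
apply: (eq_measurable_fun (fun x => Num.sqrt (Re (f x) ^+ 2 + Im (f x) ^+ 2))).
  by move=> x _; case: (f x).
apply: (measurableT_comp (f := @Num.sqrt R)).
  by apply: continuous_measurable_fun; exact: sqrt_continuous.
by apply: measurable_funD; exact: measurable_funX.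
Qed.

End measurable_cfun_theory.

Section L2_functions.
Context d (X : measurableType d) (R : realType).
Variable mu : {measure set X -> \bar R}.
Implicit Types f g : X -> R[i].

Definition cL2norm f : \bar R := ('N[mu]_2%:E[EFin \o (@normc R \o f)])%E.

Definition cL2 : {pred X -> R[i]} :=
  mem [set f | measurable_cfun f /\ (cL2norm f < +oo)%E].

Lemma cL2norm_ge0 f : (0 <= cL2norm f)%E.
Proof. exact: Lnorm_ge0. Qed.

Let Lnorm2E (h : X -> R) :
  'N[mu]_2%:E[EFin \o h]%E = ((\int[mu]_x (h x ^+ 2)%:E) `^ 2^-1)%E.
Proof.
rewrite unlock; congr (_ `^ _)%E; apply: eq_integral => x _.
by rewrite abse_EFin poweR_EFin powR_mulrn ?normr_ge0// real_normK ?num_real.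
Qed.

Lemma cL2normE f :
  cL2norm f = ((\int[mu]_x (normc (f x) ^+ 2)%:E) `^ 2^-1)%E.
Proof. exact: Lnorm2E. Qed.

Lemma cL2normD f g : measurable_cfun f -> measurable_cfun g ->
  (cL2norm (f + g)%R <= cL2norm f + cL2norm g)%E.
Proof.
move=> mf mg.
have m1 := measurable_normc mf; have m2 := measurable_normc mg.
apply: le_trans (minkowski_EFin mu m1 m2 (ler1n _ 2)).
have int_ge0 (h : X -> R) : ((0:R)%:E <= \int[mu]_x (h x ^+ 2)%:E)%E.
  by apply: integral_ge0 => x _; rewrite lee_fin sqr_ge0.
rewrite cL2normE (Lnorm2E (fun x => normc (f x) + normc (g x))).
apply: gt0_ler_poweR; rewrite ?invr_ge0 ?in_itv/= ?leey ?andbT ?int_ge0//.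
apply: ge0_le_integral => //.
- by move=> x _; rewrite lee_fin sqr_ge0.
- by apply/measurable_EFinP/measurable_funX/measurable_normc/measurable_cfunD.
- by apply/measurable_EFinP/measurable_funX/measurable_funD.
- by move=> x _; rewrite lee_fin lerXn2r ?nnegrE ?addr_ge0 ?normc_ge0 ?le_normcD.
Qed.

Lemma cL2normZ (a : R[i]) f : measurable_cfun f ->
  cL2norm (a *: f)%R = ((normc a)%:E * cL2norm f)%E.
Proof.
move=> mf; rewrite !cL2normE.
under eq_integral do rewrite fctE normcM exprMn EFinM.
have na : 0 <= normc a by case: (a) => *; exact: sqrtr_ge0.
rewrite ge0_integralZl_EFin ?sqr_ge0//; last 2 first.
- by move=> x _; rewrite lee_fin sqr_ge0.
- apply/measurable_EFinP; apply: measurable_funX; exact: measurable_normc.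
rewrite poweRM ?lee_fin ?sqr_ge0//; last first.
  by apply: integral_ge0 => x _; rewrite lee_fin sqr_ge0.
by rewrite poweR_EFin powR12_sqrt ?sqr_ge0// sqrtr_sqr ger0_norm.
Qed.

Lemma ae_eq_cL2norm f g : measurable_cfun f -> measurable_cfun g ->
  f = g %[ae mu] -> cL2norm f = cL2norm g.
Proof.
move=> mf mg fg; rewrite !cL2normE; congr (_ `^ _)%E.
apply: ae_eq_integral => //.
- by apply/measurable_EFinP/measurable_funX/measurable_normc.
- by apply/measurable_EFinP/measurable_funX/measurable_normc.
- by apply: filterS fg => x + _ => /(_ I) ->.
Qed.

Lemma cL2norm0 : cL2norm 0 = 0%E.
Proof.
rewrite -(Lnorm0 mu (p := 2%:E)); last by rewrite eqe pnatr_eq0.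
by apply: eq_Lnorm => x; congr EFin; exact: normc0.
Qed.

Lemma cL2norm_eq0 f : measurable_cfun f -> cL2norm f = 0%E -> f = 0 %[ae mu].
Proof.
move=> /measurable_normc/measurable_EFinP mf /Lnorm_eq0_eq0.
move=> /(_ mf); rewrite lte_fin ltr0n => /(_ isT).
by apply: filterS => x /(_ I)/= [] /eq0_normc fx _.
Qed.

Lemma cL2_submod_closed : submod_closed cL2.
Proof.
split=> [|a f g].
  rewrite inE; split; first exact: measurable_cfun0.
  by rewrite cL2norm0.
rewrite !inE => -[mf nf] [mg ng].
have maf : measurable_cfun (a *: f).
  by apply: measurable_cfunM => //; split; exact: measurable_cst.
split; first exact: measurable_cfunD.
apply: le_lt_trans (cL2normD maf mg) _; rewrite lte_add_pinfty//.
by rewrite cL2normZ// lte_mul_pinfty// lee_fin normc_ge0.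
Qed.
HB.instance Definition _ :=
  GRing.isSubmodClosed.Build _ _ cL2 cL2_submod_closed.

Record cL2fun := CL2fun { cL2_val :> X -> R[i] ; _ : cL2_val \in cL2 }.
HB.instance Definition _ := [isSub for cL2_val].
HB.instance Definition _ := [Choice of cL2fun by <:].
HB.instance Definition _ := [SubChoice_isSubLmodule of cL2fun by <:].

Lemma cL2fun_measurable (f : cL2fun) : measurable_cfun f.
Proof. by have := valP f; rewrite inE => -[]. Qed.

Lemma cL2fun_lty (f : cL2fun) : (cL2norm f < +oo)%E.
Proof. by have := valP f; rewrite inE => -[]. Qed.

Definition cL2_null : {pred cL2fun} := mem [set f : cL2fun | f = 0 %[ae mu]].

Lemma cL2_null_submod_closed : submod_closed cL2_null.
Proof.
split=> [|a f g]; first by rewrite inE; exact: aeW.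
rewrite !inE => f0 g0; apply: filterS2 f0 g0 => x f0 g0 _.
by rewrite -[LHS]/(a *: f x + g x) f0// g0// scaler0 addr0.
Qed.
HB.instance Definition _ :=
  GRing.isSubmodClosed.Build _ _ cL2_null cL2_null_submod_closed.

End L2_functions.

Section L2_space.
Context d (X : measurableType d) (R : realType).
Variable mu : {measure set X -> \bar R}.
Local Open Scope quotient_scope.

Definition L2 : Type := Quotient.quot (@cL2_null d X R mu).
HB.instance Definition _ := GRing.Zmodule.on L2.
HB.instance Definition _ := EqQuotient.on L2.
Definition L2_repr (f : L2) : X -> R[i] := repr f : cL2fun mu.
Coercion L2_repr : L2 >-> Funclass.

Lemma L2_eqP (f g : cL2fun mu) :
  \pi_L2 f = \pi_L2 g <-> f = g %[ae mu].
Proof.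
rewrite (rwP eqP) -Quotient.idealrBE inE; split; apply: filterS => x /[apply].
  by rewrite -[LHS]/(f x - g x) => /subr0_eq.
by move=> fg; rewrite -[LHS]/(f x - g x) fg subrr.
Qed.

Lemma L2_reprP (f : cL2fun mu) : L2_repr (\pi_L2 f) = f %[ae mu].
Proof. by apply/L2_eqP; rewrite reprK. Qed.

Lemma pi_L2D (f g : cL2fun mu) : \pi_L2 (f + g) = \pi_L2 f + \pi_L2 g :> L2.
Proof. exact: Quotient.pi_add. Qed.

Lemma pi_L20 : \pi_L2 0 = 0 :> L2.
Proof. exact: pi_zeror. Qed.

Definition L2_scale (a : R[i]) (f : L2) : L2 := \pi_L2 (a *: repr f).

Lemma pi_L2_scale a (f : cL2fun mu) : L2_scale a (\pi_L2 f) = \pi_L2 (a *: f).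
Proof.
apply/L2_eqP; apply: filterS (L2_reprP f) => x /[apply] ff.
by rewrite -[LHS]/(a *: L2_repr (\pi_L2 f) x) -[RHS]/(a *: f x) ff.
Qed.

Let L2_scaleA a b f : L2_scale a (L2_scale b f) = L2_scale (a * b) f.
Proof.
by rewrite -[f]reprK (pi_L2_scale b (repr f)) !pi_L2_scale scalerA.
Qed.

Let L2_scale1 : left_id 1 L2_scale.
Proof. by move=> f; rewrite -[f]reprK pi_L2_scale scale1r. Qed.

Let L2_scaleDr : right_distributive L2_scale +%R.
Proof.
move=> a f g; rewrite -[f]reprK -[g]reprK -pi_L2D !pi_L2_scale.
by rewrite scalerDr pi_L2D.
Qed.

Let L2_scaleDl f : {morph L2_scale^~ f : a b / a + b}.
Proof. by move=> a b; rewrite -[f]reprK !pi_L2_scale scalerDl pi_L2D. Qed.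

HB.instance Definition _ := GRing.Zmodule_isLmodule.Build R[i] L2
  L2_scaleA L2_scale1 L2_scaleDr L2_scaleDl.

Lemma L2_reprD (f g : L2) : L2_repr (f + g) = L2_repr f + L2_repr g %[ae mu].
Proof.
have -> : f + g = \pi_L2 (repr f + repr g) by rewrite pi_L2D !reprK.
exact: L2_reprP.
Qed.

Lemma L2_reprZ a (f : L2) : L2_repr (a *: f) = a *: L2_repr f %[ae mu].
Proof. exact: (L2_reprP (a *: repr f)). Qed.

Definition L2_norm (f : L2) : R[i] := (fine (cL2norm mu f))%:C.

Lemma L2_measurable (f : L2) : measurable_cfun f.
Proof. exact: cL2fun_measurable. Qed.

Lemma L2_normE f : (fine (cL2norm mu (L2_repr f)))%:E = cL2norm mu f.
Proof. by rewrite fineK// ge0_fin_numE ?cL2norm_ge0 ?cL2fun_lty. Qed.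

Let L2_normD f g : L2_norm (f + g) <= L2_norm f + L2_norm g.
Proof.
rewrite -rmorphD lecR -lee_fin EFinD !L2_normE.
apply: le_trans (cL2normD _ (L2_measurable f) (L2_measurable g)).
rewrite le_eqVlt; apply/orP; left; apply/eqP; apply: ae_eq_cL2norm.
- exact: L2_measurable.
- by apply: measurable_cfunD; exact: L2_measurable.
- exact: L2_reprD.
Qed.

Let L2_normZ a f : L2_norm (a *: f) = `|a| * L2_norm f.
Proof.
rewrite -[`|a|]/((normc a)%:C) -rmorphM; congr (_%:C).
apply: EFin_inj; rewrite EFinM !L2_normE -cL2normZ; last exact: L2_measurable.
apply: ae_eq_cL2norm; [exact: L2_measurable| |exact: L2_reprZ].
by apply: measurable_cfunM; [split; exact: measurable_cst|exact: L2_measurable].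
Qed.

Let L2_norm0_eq0 f : L2_norm f = 0 -> f = 0.
Proof.
move=> /complexI f0; have /esym := L2_normE f; rewrite f0.
move=> /(cL2norm_eq0 (L2_measurable f)) {}f0.
by rewrite -[f]reprK -pi_L20; apply/L2_eqP.
Qed.

HB.instance Definition _ :=
  Lmodule_isNormed.Build R[i] L2 L2_normD L2_normZ L2_norm0_eq0.

Definition L2_inner (f g : L2) : R[i] :=
  (\int[mu]_x Re (f x * conjc (g x))) +i* (\int[mu]_x Im (f x * conjc (g x))).

Lemma L2_innerff f : L2_inner f f = `|f| ^+ 2.
Proof.
rewrite -[`|f|]/(L2_norm f) -rmorphXn /L2_inner.
have mulJ z : z * conjc z = (normc z ^+ 2)%:C.
  by rewrite -sqr_normc rmorphXn.
rewrite -[RHS]/(_ +i* 0); congr Complex; under eq_Rintegral do rewrite mulJ.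
- rewrite /= cL2normE fine_poweR powR12_sqrt ?sqr_sqrtr// fine_ge0//.
  + by apply: integral_ge0 => x _; rewrite lee_fin sqr_ge0.
  + by apply: integral_ge0 => x _; rewrite lee_fin sqr_ge0.
- by rewrite /= /Rintegral integral0.
Qed.

End L2_space.

(* An unbounded operator in H is represented by its graph: A (f, g) means     *)
(* that f belongs to the domain of A and that A f = g.                        *)
Section unbounded_operators.
Context (K : numFieldType) (H : normedModType K).
Implicit Types A B : set (H * H).

Definition op_dom A : set H := [set f | exists g, A (f, g)].

Definition op_add A B : set (H * H) :=
  [set fh | exists g1 g2, [/\ A (fh.1, g1), B (fh.1, g2) & fh.2 = g1 + g2]].

Definition op_mul A B : set (H * H) :=
  [set fh | exists2 g, B (fh.1, g) & A (g, fh.2)].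

Definition densely_defined A : Prop := dense (op_dom A).

End unbounded_operators.

Section L2_operators.
Context d (X : measurableType d) (R : realType).
Variable mu : {measure set X -> \bar R}.

(* The graph of the Hilbert space adjoint; for linear A, it is single-valued  *)
(* exactly when A is densely defined.                                         *)
Definition adjoint (A : set (L2 mu * L2 mu)) : set (L2 mu * L2 mu) :=
  [set gh | forall f f', A (f, f') -> L2_inner f' gh.1 = L2_inner f gh.2].

Definition weighted_measure (w : X -> R[i]) (D : set X) : \bar R :=
  (\int[mu]_(x in D) (normc (w x) ^+ 2)%:E)%E.

(* The class f is evaluated through an arbitrary representative, which is     *)
(* immaterial by ae_eq_wcomp.                                                 *)
Definition wcomp_op (phi : X -> X) (w : X -> R[i]) : set (L2 mu * L2 mu) :=
  [set fg : L2 mu * L2 mu | (fun x => w x * fg.1 (phi x)) \in cL2 mu /\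
            L2_repr fg.2 = (fun x => w x * fg.1 (phi x)) %[ae mu]].

Lemma ae_eq_wcomp (phi : X -> X) (w f f' : X -> R[i]) :
  measurable_fun [set: X] phi -> measurable_cfun w ->
  pushforward (weighted_measure w) phi `<< mu -> f = f' %[ae mu] ->
  (fun x => w x * f (phi x)) = (fun x => w x * f' (phi x)) %[ae mu].
Proof.
move=> mphi mw /null_content_dominatesP ac [N [mN N0 ff'N]].
have mphiN : measurable (phi @^-1` N).
  by rewrite -[X in measurable X]setTI; exact: mphi.
have := ac N mN N0; rewrite /pushforward /weighted_measure => w0.
have : (fun x => (normc (w x) ^+ 2)%:E) = cst 0%E %[ae mu in phi @^-1` N].
  apply/ae_eq_integral_abs => //.
    apply/measurable_EFinP/measurable_funX; apply: measurable_funTS.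
    exact: measurable_normc.
  rewrite -[RHS]w0; apply: eq_integral => x _.
  by rewrite gee0_abs// lee_fin sqr_ge0.
apply: filterS => x wx _.
have [Nx|Nx] := pselect (N (phi x)).
  have [] := wx Nx; move/eqP; rewrite expf_eq0/= => /eqP/eq0_normc ->.
  by rewrite !mul0r.
by congr (_ * _); apply: contrapT => ff'; apply/Nx/ff'N => /(_ I).
Qed.

End L2_operators.
Arguments wcomp_op {d X R} mu phi w.

(* Main.v *)
Require Import Defs.
From HB Require Import structures.
From mathcomp Require Import all_boot all_order all_algebra.
From mathcomp Require Import all_classical all_reals all_analysis.
From mathcomp Require Import measurable_realfun complex ring lra.

Set Implicit Arguments.
Unset Strict Implicit.
Unset Printing Implicit Defensive.
Import Order.TTheory GRing.Theory Num.Theory.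
Import complex ComplexField.Normc.
Import numFieldNormedType.Exports.

Local Open Scope classical_set_scope.
Local Open Scope complex_scope.
Local Open Scope ring_scope.

(** Write C for the weighted composition operator with symbol phi and weight w,
and nu for the image under phi of the measure |w|^2 mu. Formally nu has a
density h with respect to mu, and dense definiteness of C amounts to h being
finite almost everywhere. On a set Y where h is at most c, multiplication by
the indicator of Y followed by C is bounded, with norm at most the square root
of c; hence if f vanishes where phi is outside Y, then f lies in the domain of
the adjoint, C* f lives on Y, and C* f lies in the domain of C. So f is in the
domain of C C*. Countably many such sets Y cover the space, so their preimages
by phi exhaust it; where w = 0, the values of f do not affect C* f and need no
truncation. Truncating f to the intersection of two such preimages, one for
each operator, puts it in the domain of both products, and the truncations
converge to f.

The proof below avoids the Riesz representation theorem by constructing C* f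
explicitly. The truncation also enforces that |f| and |w| are comparable, say
|f| <= M |w| and |w| <= M |f| where both are nonzero. The real and imaginary
parts b of w f^* are then integrable and dominated by M |w|^2. Split b into
positive and negative parts, so that b >= 0. The image under phi of the measure
b mu has a Radon-Nikodym density g ([transfer_density]), which represents the
adjoint by construction. The self-improving estimate

  int g^2 = int (g o phi) b <= M int_(phi in Y) (g o phi) |w|^2 <= M c int g

places g in L^2, and int |w|^2 (g o phi)^2 <= c int g^2 places it in the domain
of C ([exists_transfer_ge0], [op_dom_wcomp_adjoint]).

The sets Y come from the domain of C itself ([sigma_weight_bounded_support]):
for f in the domain, |w|^2 |f o phi|^2 mu is finite, so its image under phi has
a finite density h', and nu is bounded by k^2 mu where |f|^2 >= 1/k and
h' <= k. These sets cover the support of f. By density of the domain, countably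
many supports cover the space up to a null set, on which nu vanishes as well
([sigma_weight_boundedT]). *)

(** * Densities of image measures *)

Section density.
Context d (X : measurableType d) (R : realType).
Local Open Scope ereal_scope.

(** The measure with density [a] is absolutely continuous, and its
Radon-Nikodym derivative is [a] by uniqueness; the integration rule is then the
change of variables for Radon-Nikodym derivatives. *)
Lemma exists_density_measure (mu : {sigma_finite_measure set X -> \bar R})
    (a : X -> \bar R) :
  measurable_fun [set: X] a -> (forall x, 0 <= a x) ->
  \int[mu]_x a x < +oo ->
  exists nu : {finite_measure set X -> \bar R},
    (forall A, nu A = \int[mu]_(x in A) a x) /\
    forall p : X -> \bar R, measurable_fun [set: X] p -> (forall x, 0 <= p x) ->
      \int[nu]_x p x = \int[mu]_x (p x * a x).
Proof.
move=> ma a0 ia.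
pose nu0 (A : set X) := \int[mu]_(x in A) a x.
have nu00 : nu0 set0 = 0 by rewrite /nu0 integral_set0.
have nu0_ge0 A : 0 <= nu0 A by apply: integral_ge0 => x _; exact: a0.
have nu0_sa : semi_sigma_additive nu0.
  exact: semi_sigma_additive_nng_induced.
have nu0_fin : fin_num_fun nu0.
  move=> A mA; rewrite ge0_fin_numE//; apply: le_lt_trans ia.
  by apply: ge0_subset_integral.
pose mM := isMeasure.Build _ X R nu0 nu00 nu0_ge0 nu0_sa.
pose num : {measure set X -> \bar R} := HB.pack nu0 mM.
pose fM := Measure_isFinite.Build _ X R num nu0_fin.
pose nu : {finite_measure set X -> \bar R} := HB.pack nu0 mM fM.
exists nu; split => // p mp p0.
have numu : nu `<< mu.
  apply/null_content_dominatesP => A mA A0; rewrite /nu/= /nu0.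
  by apply: null_set_integral => //; exact: measurable_funTS.
rewrite -(Radon_Nikodym_SigmaFinite.change_of_variables numu)//.
apply: ae_eq_integral => //.
- apply: emeasurable_funM => //.
  exact: measurable_int (Radon_Nikodym_SigmaFinite.f_integrable numu).
- exact: emeasurable_funM.
have : ae_eq mu setT (Radon_Nikodym_SigmaFinite.f nu mu) a.
  apply: integral_ae_eq => //.
    exact: (Radon_Nikodym_SigmaFinite.f_integrable numu).
  move=> E _ mE.
  by rewrite -Radon_Nikodym_SigmaFinite.f_integral.
by apply: filterS => x /[apply] ->.
Qed.

(** Integration against [a] after composing with [phi] factors through the
image under [phi] of the measure [a mu], and hence through the Radon-Nikodym
derivative [g] of that image. *)
Lemma transfer_density (mu : {sigma_finite_measure set X -> \bar R})
    (phi : X -> X) (a : X -> R) :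
  measurable_fun [set: X] phi -> measurable_fun [set: X] a ->
  (forall x, (0 <= a x)%R) -> \int[mu]_x (a x)%:E < +oo ->
  (forall N, measurable N -> mu N = 0 ->
    {ae mu, forall x, N (phi x) -> a x = 0%R}) ->
  exists g : X -> R, [/\ measurable_fun [set: X] g, forall x, (0 <= g x)%R &
    forall p : X -> R, measurable_fun [set: X] p -> (forall x, (0 <= p x)%R) ->
    \int[mu]_x (p (phi x) * a x)%:E = \int[mu]_x (p x * g x)%:E].
Proof.
move=> mphi ma a0 ia ac.
have [||//|k [kE kI]] := @exists_density_measure mu (EFin \o a).
- exact/measurable_EFinP.
- by move=> x; rewrite /= lee_fin.
have mphiA A : measurable A -> measurable (phi @^-1` A).
  by move=> mA; rewrite -[X in measurable X]setTI; exact: mphi.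
pose nu0 (A : set X) := pushforward k phi A.
have nu00 : nu0 set0 = 0 by rewrite /nu0 /pushforward preimage_set0 measure0.
have nu0_ge0 A : 0 <= nu0 A by exact: measure_ge0.
have nu0_sa : semi_sigma_additive nu0.
  move=> F mF tF mUF; rewrite /nu0 /pushforward preimage_bigcup.
  apply: measure_semi_sigma_additive.
  - by move=> n; exact: mphiA.
  - apply/trivIsetP => /= i j _ _ ij; rewrite -preimage_setI.
    by move/trivIsetP : tF => /(_ _ _ _ _ ij) ->//; rewrite preimage_set0.
  - by rewrite -preimage_bigcup; exact: mphiA.
have nu0_fin : fin_num_fun nu0.
  by move=> A mA; rewrite fin_num_measure//; exact: mphiA.
pose mM := isMeasure.Build _ X R nu0 nu00 nu0_ge0 nu0_sa.
pose num : {measure set X -> \bar R} := HB.pack nu0 mM.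
pose fM := Measure_isFinite.Build _ X R num nu0_fin.
pose nu : {finite_measure set X -> \bar R} := HB.pack nu0 mM fM.
have numu : nu `<< mu.
  apply/null_content_dominatesP => A mA A0.
  rewrite /nu/= /nu0 /pushforward kE -(integral0 mu (phi @^-1` A)).
  apply: ae_eq_integral => //; first exact: mphiA.
    exact/measurable_funTS/measurable_EFinP.
  by apply: filterS (ac A mA A0) => x ax /ax /= ->.
pose g := Radon_Nikodym_SigmaFinite.f nu mu.
have gE x : (fine (g x))%:E = g x.
  by rewrite fineK// Radon_Nikodym_SigmaFinite.f_fin_num.
exists (fine \o g); split.
- apply/measurable_EFinP; apply: (eq_measurable_fun g) => //.
    by move=> x _ /=; rewrite gE.
  exact: measurable_int (Radon_Nikodym_SigmaFinite.f_integrable numu).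
- move=> x /=; apply: fine_ge0.
  exact: Radon_Nikodym_SigmaFinite.f_ge0.
move=> p mp p0.
have mpphi : measurable_fun [set: X] (fun x => p (phi x)).
  exact: measurableT_comp.
under eq_integral do rewrite EFinM.
under [RHS]eq_integral do rewrite EFinM /= gE.
rewrite (Radon_Nikodym_SigmaFinite.change_of_variables numu (f := EFin \o p))//.
- rewrite -(kI (fun x => (p (phi x))%:E))//.
  + rewrite [RHS](@ge0_integral_pushforward _ _ _ _ _ phi mphi k setT (EFin \o p))//.
    * exact/measurable_EFinP.
    * by move=> x _; rewrite /= lee_fin.
  + exact/measurable_EFinP.
  + by move=> x; rewrite /= lee_fin.
- exact/measurable_EFinP.
Qed.

End density.

(** * Measurable and square-integrable complex functions *)

Section auxiliary.
Context d (X : measurableType d) (R : realType).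
Variable mu : {measure set X -> \bar R}.
Implicit Types f g : X -> R[i].

Lemma le_integral_EFin (f g : X -> R) :
  measurable_fun [set: X] f -> measurable_fun [set: X] g ->
  (forall x, 0 <= f x) -> (forall x, f x <= g x) ->
  (\int[mu]_x (f x)%:E <= \int[mu]_x (g x)%:E)%E.
Proof.
move=> mf mg f0 fg; apply: ge0_le_integral => //.
- by move=> x _; rewrite lee_fin.
- exact/measurable_EFinP.
- exact/measurable_EFinP.
- by move=> x _; rewrite lee_fin.
Qed.

Lemma integral_EFinZl (c : R) (f : X -> R) : measurable_fun [set: X] f ->
  0 <= c -> (forall x, 0 <= f x) ->
  (\int[mu]_x (c * f x)%:E = c%:E * \int[mu]_x (f x)%:E)%E.
Proof.
move=> mf c0 f0; under eq_integral do rewrite EFinM.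
by rewrite ge0_integralZl_EFin//; [move=> x _; rewrite lee_fin|exact/measurable_EFinP].
Qed.

Lemma integrable_EFin_ge0 (f : X -> R) : measurable_fun [set: X] f ->
  (forall x, 0 <= f x) -> (\int[mu]_x (f x)%:E < +oo)%E ->
  mu.-integrable [set: X] (EFin \o f).
Proof.
move=> mf f0 fI; apply/integrableP; split; first exact/measurable_EFinP.
by under eq_integral do rewrite /= ger0_norm//.
Qed.

Lemma integral_EFin_lty (f : X -> R) : (forall x, 0 <= f x) ->
  mu.-integrable [set: X] (EFin \o f) -> (\int[mu]_x (f x)%:E < +oo)%E.
Proof.
move=> f0 /integrableP[_]; congr (_ < _)%E; apply: eq_integral => x _.
by rewrite /= ger0_norm.
Qed.

Lemma le_integrable_EFin (f g : X -> R) : measurable_fun [set: X] f ->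
  (forall x, `|f x| <= g x) -> mu.-integrable [set: X] (EFin \o g) ->
  mu.-integrable [set: X] (EFin \o f).
Proof.
move=> mf fg; apply: le_integrable => //; first exact/measurable_EFinP.
by move=> x _; rewrite /= lee_fin; apply: le_trans (fg x) (ler_norm _).
Qed.

Lemma measurable_pos_neg_parts (b : X -> R) : measurable_fun [set: X] b ->
  exists b1 b2 : X -> R, [/\
    measurable_fun [set: X] b1 /\ (forall x, 0 <= b1 x <= `|b x|),
    measurable_fun [set: X] b2 /\ (forall x, 0 <= b2 x <= `|b x|) &
    forall x, b x = b1 x - b2 x].
Proof.
move=> mb.
have mnb : measurable_fun [set: X] (fun x => `|b x|) by exact: measurableT_comp.
exists (fun x => (`|b x| + b x) / 2), (fun x => (`|b x| - b x) / 2).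
have bound x : - `|b x| <= b x <= `|b x| by rewrite -ler_norml.
split; last by move=> x; lra.
- split=> [|x]; last by have := bound x; lra.
  by apply: measurable_funM; [exact: measurable_funD|exact: measurable_cst].
- split=> [|x]; last by have := bound x; lra.
  by apply: measurable_funM; [exact: measurable_funB|exact: measurable_cst].
Qed.

Lemma measurable_normc_sqr f : measurable_cfun f ->
  measurable_fun [set: X] (fun x => normc (f x) ^+ 2).
Proof. by move=> mf; apply/measurable_funX/measurable_normc. Qed.

Lemma Re_le_normc (z : R[i]) : `|complex.Re z| <= normc z.
Proof.
case: z => a b; rewrite /= -sqrtr_sqr ler_wsqrtr//.
by rewrite lerDl sqr_ge0.
Qed.

Lemma Im_le_normc (z : R[i]) : `|complex.Im z| <= normc z.
Proof.
case: z => a b; rewrite /= -sqrtr_sqr ler_wsqrtr//.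
by rewrite lerDr sqr_ge0.
Qed.

Lemma normc_conjc (z : R[i]) : normc (conjc z) = normc z.
Proof. by case: z => a b; rewrite /= sqrrN. Qed.

Lemma normc_gt0 (z : R[i]) : (0 < normc z) = (z != 0).
Proof.
rewrite lt_neqAle normc_ge0 andbT eq_sym; congr (~~ _); apply/eqP/eqP.
  exact: eq0_normc.
by move=> ->; exact: normc0.
Qed.

Lemma measurable_support f : measurable_cfun f ->
  measurable [set x | f x != 0].
Proof.
move=> mf; rewrite (_ : mkset _ = ~` ([set: X] `&` [set x | normc (f x) <= 0])).
  by apply/measurableC/measurable_fun_le => //; exact: measurable_normc.
apply/seteqP; split => x /=; rewrite -normc_gt0 => fx.
  by move=> [_]; rewrite leNgt fx.
by rewrite ltNge; apply/negP => fx0; apply: fx.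
Qed.

Lemma measurable_conjc (f : X -> R[i]) :
  measurable_cfun f -> measurable_cfun (fun x => conjc (f x)).
Proof.
move=> [mf1 mf2]; split.
  by apply: eq_measurable_fun mf1 => x _; case: (f x).
by apply: eq_measurable_fun (measurable_funN mf2) => x _ /=; case: (f x).
Qed.

Lemma measurable_cfunB f g :
  measurable_cfun f -> measurable_cfun g -> measurable_cfun (fun x => f x - g x).
Proof.
move=> mf mg; have -> : (fun x => f x - g x) = f + (fun x => (-1) * g x).
  by apply/funext => x; rewrite fctE mulN1r.
by apply: measurable_cfunD => //; apply: measurable_cfunM.
Qed.

Lemma normc_real (a : R) : normc a%:C = `|a|.
Proof. by rewrite /= expr0n addr0 sqrtr_sqr. Qed.

Lemma measurable_cfun_real (a : X -> R) : measurable_fun [set: X] a ->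
  measurable_cfun (fun x => (a x)%:C).
Proof. by move=> ma; split => //=; exact: measurable_cst. Qed.

Lemma measurable_cfun_comp (phi : X -> X) f : measurable_fun [set: X] phi ->
  measurable_cfun f -> measurable_cfun (fun x => f (phi x)).
Proof.
move=> mphi [mf1 mf2]; split.
  exact: (measurableT_comp mf1 mphi).
exact: (measurableT_comp mf2 mphi).
Qed.

Lemma cL2norm_ltyE f : measurable_cfun f ->
  (cL2norm mu f < +oo)%E = (\int[mu]_x (normc (f x) ^+ 2)%:E < +oo)%E.
Proof.
move=> mf; rewrite cL2normE; apply/idP/idP.
  by apply: lty_poweRy; rewrite invr_neq0.
exact: poweR_lty.
Qed.

Lemma in_cL2 f : f \in cL2 mu <->
  measurable_cfun f /\ (\int[mu]_x (normc (f x) ^+ 2)%:E < +oo)%E.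
Proof.
by rewrite inE/=; split=> -[mf]; rewrite cL2norm_ltyE.
Qed.

Lemma in_cL2_indic A : measurable A -> (mu A < +oo)%E ->
  (fun x => (\1_A x)%:C : R[i]) \in cL2 mu.
Proof.
move=> mA A_fin; apply/in_cL2; split.
  by apply: measurable_cfun_real; exact: measurable_indic.
rewrite (_ : integral _ _ _ = mu A)// -(setIT A) -integral_indic//.
apply: eq_integral => x _; rewrite normc_real real_normK ?num_real// !indicE.
by rewrite -natrX setIT; case: (_ \in _).
Qed.

Lemma cL2norm_sqr f : f \in cL2 mu ->
  ((fine (cL2norm mu f) ^+ 2)%:E = \int[mu]_x (normc (f x) ^+ 2)%:E)%E.
Proof.
move=> /in_cL2[mf fI]; rewrite cL2normE.
have I0 : (0 <= \int[mu]_x (normc (f x) ^+ 2)%:E)%E.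
  by apply: integral_ge0 => x _; rewrite lee_fin sqr_ge0.
rewrite fine_poweR powR12_sqrt ?fine_ge0// sqr_sqrtr ?fine_ge0//.
by rewrite fineK// ge0_fin_numE.
Qed.

Local Open Scope quotient_scope.

Lemma L2_norm_pi (f : cL2fun mu) :
  `|\pi_(L2 mu) f : L2 mu| = (fine (cL2norm mu f))%:C.
Proof.
rewrite -[LHS]/((fine (cL2norm mu (L2_repr (\pi_(L2 mu) f))))%:C).
congr ((fine _)%:C); apply: ae_eq_cL2norm; [exact: L2_measurable| |exact: L2_reprP].
exact: cL2fun_measurable.
Qed.

Lemma L2_dist_lt (f g : cL2fun mu) (e : R) : 0 <= e ->
  (`|(\pi_(L2 mu) f : L2 mu) - \pi_(L2 mu) g| < e%:C) =
  (\int[mu]_x (normc (f x - g x) ^+ 2)%:E < (e ^+ 2)%:E)%E.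
Proof.
move=> e0.
have -> : (\pi_(L2 mu) f : L2 mu) - \pi_(L2 mu) g = \pi_(L2 mu) (f - g).
  by apply: (addIr (\pi_(L2 mu) g : L2 mu)); rewrite subrK -pi_L2D subrK.
rewrite L2_norm_pi ltcR -[RHS]/((\int[mu]_x (normc ((f - g) x) ^+ 2)%:E < (e ^+ 2)%:E)%E).
rewrite -cL2norm_sqr ?(valP (f - g))// lte_fin ltr_pXn2r//.
by rewrite nnegrE fine_ge0// cL2norm_ge0.
Qed.

Lemma L2_inner_ae (f g : L2 mu) (f' g' : X -> R[i]) :
  measurable_cfun f' -> measurable_cfun g' ->
  L2_repr f = f' %[ae mu] -> L2_repr g = g' %[ae mu] ->
  L2_inner f g = (\int[mu]_x complex.Re (f' x * conjc (g' x))) +i*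
    (\int[mu]_x complex.Im (f' x * conjc (g' x))).
Proof.
move=> mf' mg' ff' gg'; rewrite /L2_inner.
have [m1 m2] := measurable_cfunM (L2_measurable f) (measurable_conjc (L2_measurable g)).
have [m1' m2'] := measurable_cfunM mf' (measurable_conjc mg').
have fg : {ae mu, forall x, f x * conjc (g x) = f' x * conjc (g' x)}.
  by apply: filterS2 ff' gg' => x -> // ->.
congr Complex; congr fine; apply: ae_eq_integral => //; try exact/measurable_EFinP.
- by apply: filterS fg => x ->.
- by apply: filterS fg => x ->.
Qed.

Lemma dense_L2_approx (D : set (L2 mu)) : dense D ->
  forall (f : cL2fun mu) (e : R), 0 < e ->
  exists2 g : L2 mu, D g &
    (\int[mu]_x (normc (f x - g x) ^+ 2)%:E < (e ^+ 2)%:E)%E.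
Proof.
move=> dD f e e0.
have [|g [fg Dg]] := dD (ball (\pi_(L2 mu) f : L2 mu) e%:C) _ (ball_open _ _).
  by exists (\pi_(L2 mu) f); apply: ballxx; rewrite ltcR.
exists g => //.
move: fg; rewrite -ball_normE /ball_ /=.
by rewrite -{1}[g](@reprK _ (L2 mu)) L2_dist_lt ?ltW.
Qed.

Lemma dense_L2 (D : set (L2 mu)) :
  (forall (f : cL2fun mu) (e : R), 0 < e -> exists2 g : cL2fun mu,
    D (\pi_(L2 mu) g) &
    (\int[mu]_x (normc (f x - g x) ^+ 2)%:E < (e ^+ 2)%:E)%E) ->
  dense D.
Proof.
move=> H O [f Of] oO.
have := open_nbhs_nbhs (conj oO Of); rewrite -nbhs_ballE => -[e e0 eO].
(* A positive element of the complex numbers is real. *)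
have eE : e = (complex.Re e)%:C.
  by move: e0; case: (e) => a b; rewrite /= ltcE/= => /andP[/eqP -> _].
have e0' : 0 < complex.Re e by move: e0; rewrite eE /= ltcR.
have [g Dg fg] := H (repr f) _ e0'.
exists (\pi_(L2 mu) g); split => //; apply: eO.
rewrite -ball_normE /ball_ /= eE -{1}[f](@reprK _ (L2 mu)).
by rewrite L2_dist_lt ?ltW.
Qed.

End auxiliary.

(** * Sets over which the weighted image measure is bounded *)

Section bounded_sets.
Context d (X : measurableType d) (R : realType).
Variable mu : {sigma_finite_measure set X -> \bar R}.
Variables (phi : X -> X) (w : X -> R[i]).
Hypothesis mphi : measurable_fun [set: X] phi.
Hypothesis mw : measurable_cfun w.
Hypothesis ac : pushforward (weighted_measure mu w) phi `<< mu.

(** With nu the image under [phi] of |w|^2 mu, this says that nu <= c mu on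
[Y]; equivalently C composed with multiplication by the indicator of [Y] is
bounded. The inequality is stated for integrals so that it can be used without
forming nu. *)
Definition weight_bounded (Y : set X) : Prop :=
  measurable Y /\ exists2 c : R, 0 <= c &
    forall p : X -> R, measurable_fun [set: X] p -> (forall x, 0 <= p x) ->
    (\int[mu]_x (\1_Y (phi x) * p (phi x) * normc (w x) ^+ 2)%:E <=
      c%:E * \int[mu]_x (p x)%:E)%E.

Let mbd Y (p : X -> R) : measurable Y -> measurable_fun [set: X] p ->
  measurable_fun [set: X]
    (fun x => \1_Y (phi x) * p (phi x) * normc (w x) ^+ 2).
Proof.
move=> mY mp; apply: measurable_funM; last exact: measurable_normc_sqr.
apply: measurable_funM; last exact: measurableT_comp.
by apply: (measurableT_comp (f := \1_Y : X -> R)) => //; exact: measurable_indic.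
Qed.

Let bd_ge0 Y (p : X -> R) : (forall x, 0 <= p x) ->
  forall x, 0 <= \1_Y (phi x) * p (phi x) * normc (w x) ^+ 2.
Proof. by move=> p0 x; rewrite mulr_ge0 ?sqr_ge0// mulr_ge0// indicE ler0n. Qed.

(** The indicator of [N] represents the zero class, so its image under C
vanishes almost everywhere. *)
Lemma ae_weight_null N : measurable N -> mu N = 0%E ->
  {ae mu, forall x, N (phi x) -> w x = 0}.
Proof.
move=> mN N0.
have : (fun x => w x * (\1_N (phi x))%:C) = (fun x => w x * 0) %[ae mu].
  apply: (@ae_eq_wcomp _ _ _ mu phi w (fun x => (\1_N x)%:C) (fun=> 0)) => //.
  exists N; split => // x /= Nx; apply: contrapT => NNx; apply: Nx => _.
  by rewrite indicE memNset.
apply: filterS => x /(_ I) /= wx Nx; move: wx.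
by rewrite indicE mem_set// mulr1 mulr0.
Qed.

Lemma weight_bounded_null N : measurable N -> mu N = 0%E -> weight_bounded N.
Proof.
move=> mN N0; split => //; exists 0 => // p mp p0.
rewrite mul0e (_ : integral _ _ _ = 0%E)//.
rewrite -[RHS](integral0 mu [set: X]); apply: ae_eq_integral => //.
- by apply/measurable_EFinP; exact: mbd.
- apply: filterS (ae_weight_null mN N0) => x wx _.
  have [Nx|Nx] := pselect (N (phi x)).
    by rewrite wx// normc0 expr0n/= mulr0.
  by rewrite indicE memNset// !mul0r.
Qed.

Lemma weight_boundedU Y Z : weight_bounded Y -> weight_bounded Z ->
  weight_bounded (Y `|` Z).
Proof.
move=> [mY [b b0 bY]] [mZ [c c0 cZ]]; split; first exact: measurableU.
exists (b + c) => [|p mp p0]; first exact: addr_ge0.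
rewrite EFinD ge0_muleDl ?lee_fin//.
apply: le_trans (leeD (bY p mp p0) (cZ p mp p0)).
rewrite -ge0_integralD//=; last first.
- by apply/measurable_EFinP; exact: mbd.
- by move=> x _; rewrite lee_fin bd_ge0.
- by apply/measurable_EFinP; exact: mbd.
- by move=> x _; rewrite lee_fin bd_ge0.
under [leRHS]eq_integral do rewrite -EFinD.
apply: le_integral_EFin.
- by apply: mbd => //; exact: measurableU.
- by apply: measurable_funD; exact: mbd.
- exact: bd_ge0.
move=> x; rewrite -!mulrDl ler_wpM2r ?sqr_ge0// ler_wpM2r//.
rewrite !indicE in_setU; case: (_ \in Y); case: (_ \in Z) => /=; lra.
Qed.

Lemma weight_bounded_bigsetU (Y : nat -> set X) n :
  (forall k, weight_bounded (Y k)) ->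
  weight_bounded (\big[setU/set0]_(k < n) Y k).
Proof.
move=> bY; elim/big_ind : _ => //; last exact: weight_boundedU.
by apply: weight_bounded_null => //; rewrite measure0.
Qed.

Definition sigma_weight_bounded (A : set X) : Prop :=
  exists2 Y : nat -> set X, (forall k, weight_bounded (Y k)) & A `<=` \bigcup_k Y k.

Lemma sigma_weight_bounded_bigcup (A : nat -> set X) :
  (forall k, sigma_weight_bounded (A k)) -> sigma_weight_bounded (\bigcup_k A k).
Proof.
move=> /(_ _)/cid2-/all_sig2[Y bY AY].
pose Z n : set X := if unpickle n is Some ij then Y ij.1 ij.2 else set0.
exists Z => [n|x [i _ Aix]].
  rewrite /Z; case: unpickle => [ij|]; first exact: bY.
  by apply: weight_bounded_null => //; rewrite measure0.
by have [j _ Yx] := AY _ _ Aix; exists (pickle (i, j)); rewrite // /Z pickleK.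
Qed.

(** The function [f] in the domain of C makes |w|^2 |f o phi|^2 integrable, so
its transfer [h] is everywhere finite. Where |f|^2 >= 1/k and h <= k, the
measure nu is at most k |f|^2 nu = k h mu <= k^2 mu. *)
Lemma sigma_weight_bounded_support (f : X -> R[i]) : measurable_cfun f ->
  (fun x => w x * f (phi x)) \in cL2 mu -> sigma_weight_bounded [set x | f x != 0].
Proof.
move=> mf /in_cL2[mwf wfI].
have [||//||h [mh h0 hE]] := @transfer_density _ _ _ mu phi
    (fun x => normc (w x * f (phi x)) ^+ 2) mphi.
- exact: measurable_normc_sqr.
- by move=> x; exact: sqr_ge0.
- move=> N mN N0; apply: filterS (ae_weight_null mN N0) => x wx Nx.
  by rewrite wx// mul0r normc0 expr0n.
pose Y k : set X :=
  [set x | 1 <= k.+1%:R * normc (f x) ^+ 2] `&` [set x | h x <= k.+1%:R].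
have mY k : measurable (Y k).
  have mfk : measurable_fun [set: X] (fun x => k.+1%:R * normc (f x) ^+ 2).
    by apply: measurable_funM; [exact: measurable_cst|exact: measurable_normc_sqr].
  apply: measurableI; rewrite -[X in measurable X]setTI.
    by apply: measurable_fun_le => //; exact: measurable_cst.
  by apply: measurable_fun_le => //; exact: measurable_cst.
exists Y => [k|x /= fx]; last first.
  have fx0 : 0 < normc (f x) ^+ 2.
    rewrite exprn_gt0// lt_neqAle normc_ge0 andbT eq_sym.
    by apply: contra fx => /eqP/eq0_normc ->.
  pose k := maxn (Num.bound (normc (f x) ^+ 2)^-1) (Num.bound (h x)).
  have ltk (y : R) : 0 <= y -> (Num.bound y <= k)%N -> y <= k.+1%:R.
    move=> y0 yk; apply: le_trans (ltW (archi_boundP y0)) _.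
    by rewrite ler_nat; apply: leq_trans yk _.
  exists k => //; split => /=; last by apply: ltk; rewrite // /k leq_maxr.
  rewrite -ler_pdivrMr// mul1r; apply: ltk; first by rewrite invr_ge0 ltW.
  by rewrite /k leq_maxl.
split => //; exists (k.+1%:R * k.+1%:R) => [|p mp p0]; first by rewrite mulr_ge0.
have mYp : measurable_fun [set: X] (fun x => \1_(Y k) x * p x).
  by apply: measurable_funM => //; exact: measurable_indic.
have Yp0 x : 0 <= \1_(Y k) x * p x by rewrite mulr_ge0// indicE ler0n.
apply: (@le_trans _ _ (\int[mu]_x (k.+1%:R * (\1_(Y k) (phi x) * p (phi x) *
    normc (w x * f (phi x)) ^+ 2))%:E)%E).
  apply: le_integral_EFin.
  - exact: mbd.
  - apply: measurable_funM; first exact: measurable_cst.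
    apply: measurable_funM; last exact: measurable_normc_sqr.
    exact: (measurableT_comp mYp mphi).
  - exact: bd_ge0.
  move=> x; rewrite indicE; case: (boolP (_ \in _)) => /=; last by rewrite !mul0r mulr0.
  rewrite inE => -[/= fk _]; rewrite !mul1r normcM exprMn.
  rewrite [leRHS](_ : _ = p (phi x) * normc (w x) ^+ 2 *
    (k.+1%:R * normc (f (phi x)) ^+ 2)); last by ring.
  by rewrite ler_peMr// mulr_ge0 ?sqr_ge0.
rewrite integral_EFinZl//; last 2 first.
- apply: measurable_funM; last exact: measurable_normc_sqr.
  exact: (measurableT_comp mYp mphi).
- by move=> x; rewrite mulr_ge0 ?sqr_ge0.
rewrite EFinM -muleA lee_wpmul2l ?lee_fin//.
rewrite (hE (fun x => \1_(Y k) x * p x))// -integral_EFinZl//.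
apply: le_integral_EFin.
- exact: measurable_funM.
- by apply: measurable_funM => //; exact: measurable_cst.
- by move=> x; rewrite mulr_ge0.
move=> x; rewrite indicE; case: (boolP (_ \in _)) => /=; last by rewrite !mul0r mulr_ge0.
by rewrite inE => -[/= _ hk]; rewrite mul1r mulrC ler_wpM2r.
Qed.

(** A set of finite measure is approximated in L^2 by elements of the domain,
so up to a null set it is covered by countably many of their supports: a point
of it outside all of them contributes 1 to every squared distance. *)
Lemma sigma_weight_boundedT : densely_defined (wcomp_op mu phi w) ->
  sigma_weight_bounded [set: X].
Proof.
move=> dd.
have [F FT F_fin] := sigma_finiteT mu.
have iF n : (fun x => (\1_(F n) x)%:C : R[i]) \in cL2 mu.
  by have [? ?] := F_fin n; exact: in_cL2_indic.
have /(_ _ _)/cid2 approx n m :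
    exists2 g : L2 mu, op_dom (wcomp_op mu phi w) g &
    (\int[mu]_x (normc ((\1_(F n) x)%:C - g x) ^+ 2)%:E < (m.+1%:R^-1 ^+ 2)%:E)%E.
  by apply: (dense_L2_approx dd (CL2fun (iF n))); rewrite invr_gt0.
pose g n m := s2val (approx n m).
have gD n m : op_dom (wcomp_op mu phi w) (g n m).
  exact: s2valP (approx n m).
have gF n m : (\int[mu]_x (normc ((\1_(F n) x)%:C - g n m x) ^+ 2)%:E <
    (m.+1%:R^-1 ^+ 2)%:E)%E.
  exact: s2valP' (approx n m).
pose S n m := [set x | g n m x != 0].
have mS n m : measurable (S n m).
  exact/measurable_support/L2_measurable.
have bS : sigma_weight_bounded (\bigcup_n \bigcup_m S n m).
  apply: sigma_weight_bounded_bigcup => n; apply: sigma_weight_bounded_bigcup => m.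
  have [h [gh _]] := gD n m.
  by apply: sigma_weight_bounded_support gh; exact: L2_measurable.
pose Z := ~` (\bigcup_n \bigcup_m S n m).
have mZ : measurable Z.
  apply: measurableC; apply: bigcup_measurable => n _.
  by apply: bigcup_measurable => m _.
have ZF0 n : mu (Z `&` F n) = 0%E.
  have [mF _] := F_fin n.
  have ZFm m : (mu (Z `&` F n) <= (m.+1%:R^-1)%:E)%E.
    apply: (@le_trans _ _ (m.+1%:R^-1 ^+ 2)%:E); last first.
      rewrite lee_fin expr2 ler_piMr ?invr_ge0//.
      by rewrite invf_le1 ?ler1n.
    apply: le_trans (ltW (gF n m)).
    rewrite -[Z `&` F n]setIT -integral_indic//; last exact: measurableI.
    apply: le_integral_EFin.
    - by apply: measurable_indic; exact: measurableI.
    - apply: measurable_normc_sqr; apply: measurable_cfunB.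
        by apply: measurable_cfun_real; exact: measurable_indic.
      exact: L2_measurable.
    - by move=> x; rewrite indicE ler0n.
    move=> x; rewrite [leLHS]indicE; case: (boolP (_ \in _)) => /= [|_]; last exact: sqr_ge0.
    rewrite inE => -[Zx Fx]; rewrite indicE mem_set//=.
    have -> : g n m x = 0.
      apply/eqP; apply: contrapT => /negP gx; apply: Zx.
      by exists n => //; exists m.
    by rewrite subr0 normc1 expr1n.
  apply/eqP; rewrite eq_le measure_ge0 andbT; apply/lee_addgt0Pr => e e0.
  rewrite add0e; have [m me] := ltr_add_invr e0.
  by apply: le_trans (ZFm m) _; rewrite lee_fin; apply: ltW; rewrite add0r in me.
have Z0 : mu Z = 0%E.
  have ZE : Z = \bigcup_n (Z `&` F n) by rewrite -setI_bigcupr -FT setIT.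
  apply: measure_negligible => //; rewrite ZE; apply: negligible_bigcup => n.
  apply/negligibleP; last exact: ZF0.
  by apply: measurableI => //; have [] := F_fin n.
(* The union of the null set with the supports, as one countable union. *)
have : sigma_weight_bounded (\bigcup_(n : nat)
    (if n is 0%N then Z else \bigcup_n \bigcup_m S n m)).
  apply: sigma_weight_bounded_bigcup => -[|n] //.
  by exists (fun=> Z) => [_|x Zx]; [exact: weight_bounded_null|exists 0%N].
move=> [Y bY YT]; exists Y => // x _; apply: YT.
have [Sx|Zx] := pselect ((\bigcup_n \bigcup_m S n m) x).
  by exists 1%N.
by exists 0%N.
Qed.

End bounded_sets.

(** * Transfer of densities along the symbol *)

Section transfer.
Context d (X : measurableType d) (R : realType).
Variable mu : {sigma_finite_measure set X -> \bar R}.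
Variable phi : X -> X.
Hypothesis mphi : measurable_fun [set: X] phi.

(** That [g] is the density of the image under [phi] of the signed measure
[b mu], tested against every function for which the left side makes sense. *)
Definition transfers (b g : X -> R) : Prop :=
  forall p : X -> R, measurable_fun [set: X] p ->
    mu.-integrable [set: X] (EFin \o (fun x => p (phi x) * b x)) ->
    mu.-integrable [set: X] (EFin \o (fun x => p x * g x)) /\
    \int[mu]_x (p (phi x) * b x) = \int[mu]_x (p x * g x).

Lemma transfersP (b g : X -> R) : measurable_fun [set: X] b ->
  measurable_fun [set: X] g -> (forall x, 0 <= b x) -> (forall x, 0 <= g x) ->
  (forall p : X -> R, measurable_fun [set: X] p -> (forall x, 0 <= p x) ->
    (\int[mu]_x (p (phi x) * b x)%:E = \int[mu]_x (p x * g x)%:E)%E) ->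
  transfers b g.
Proof.
move=> mb mg b0 g0 bg p mp pb.
have [q1 [q2 [[mq1 q1p] [mq2 q2p] pE]]] := measurable_pos_neg_parts mp.
have qI (q : X -> R) : measurable_fun [set: X] q -> (forall x, 0 <= q x <= `|p x|) ->
    [/\ mu.-integrable [set: X] (EFin \o (fun x => q (phi x) * b x)),
      mu.-integrable [set: X] (EFin \o (fun x => q x * g x)) &
      \int[mu]_x (q (phi x) * b x) = \int[mu]_x (q x * g x)].
  move=> mq q0p.
  have q0 x : 0 <= q x by have /andP[] := q0p x.
  have qp x : q x <= `|p x| by have /andP[] := q0p x.
  have qb : mu.-integrable [set: X] (EFin \o (fun x => q (phi x) * b x)).
    apply: le_integrable pb => //.
      apply/measurable_EFinP; apply: measurable_funM => //.
      exact: measurableT_comp.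
    move=> x _; rewrite /= lee_fin !normrM ler_wpM2r// ger0_norm//.
  split => //; last by rewrite /Rintegral bg.
  apply: integrable_EFin_ge0.
  - exact: measurable_funM.
  - by move=> x; rewrite mulr_ge0.
  rewrite -bg//; apply: integral_EFin_lty => // x.
  by rewrite mulr_ge0.
have [i1 j1 e1] := qI q1 mq1 q1p.
have [i2 j2 e2] := qI q2 mq2 q2p.
have bE : (fun x => p (phi x) * b x) =
    (fun x => q1 (phi x) * b x - q2 (phi x) * b x).
  by apply/funext => x; rewrite pE mulrBl.
have gE : (fun x => p x * g x) = (fun x => q1 x * g x - q2 x * g x).
  by apply/funext => x; rewrite pE mulrBl.
rewrite bE gE; split; last by rewrite !RintegralB// e1 e2.
exact: (integrableB _ j1 j2).
Qed.

Variable w : X -> R[i].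
Hypothesis mw : measurable_cfun w.
Hypothesis ac : pushforward (weighted_measure mu w) phi `<< mu.

(** Domination of [b] by |w|^2 gives int g^2 = int (g o phi) b <=
M int_(phi in Y) (g o phi) |w|^2 <= M c int g, and int g = int b is finite. One
more use of the bound over [Y] gives int |w|^2 (g o phi)^2 <= c int g^2. *)
Lemma exists_transfer_ge0 (Y : set X) (M : R) (b : X -> R) :
  weight_bounded mu phi w Y -> 0 <= M ->
  measurable_fun [set: X] b -> (forall x, 0 <= b x) ->
  (forall x, b x <= M * normc (w x) ^+ 2) ->
  (forall x, b x != 0 -> Y (phi x)) -> (\int[mu]_x (b x)%:E < +oo)%E ->
  exists g : X -> R, [/\ measurable_fun [set: X] g, transfers b g,
    (fun x => (g x)%:C : R[i]) \in cL2 mu &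
    (fun x => w x * (g (phi x))%:C) \in cL2 mu].
Proof.
move=> [mY [c c0 bY]] M0 mb b0 bM bsupp bI.
have [|g0 [mg0 g00 g0E]] := @transfer_density _ _ _ mu phi b mphi mb b0 bI.
  move=> N mN N0; apply: filterS (ae_weight_null mphi mw ac mN N0) => x wx Nx.
  apply/eqP; rewrite eq_le b0 andbT.
  by apply: le_trans (bM x) _; rewrite wx// normc0 expr0n mulr0.
(* Since [b] vanishes where phi is outside [Y], so does its density almost
   everywhere; cutting [g0] off makes this hold everywhere. *)
pose g x : R := \1_Y x * g0 x.
have mg : measurable_fun [set: X] g.
  by apply: measurable_funM => //; exact: measurable_indic.
have g_ge0 x : 0 <= g x by rewrite mulr_ge0// indicE ler0n.
have gY x : \1_Y x * g x = g x.
  by rewrite /g mulrA; congr (_ * _); rewrite indicE -natrM mulnn; case: (_ \in _).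
have gE (p : X -> R) : measurable_fun [set: X] p -> (forall x, 0 <= p x) ->
    (\int[mu]_x (p (phi x) * b x)%:E = \int[mu]_x (p x * g x)%:E)%E.
  move=> mp p0; rewrite /g; under [RHS]eq_integral do rewrite mulrCA mulrA.
  rewrite -(g0E (fun x => \1_Y x * p x)).
  - apply: eq_integral => x _; congr EFin.
    have [->|/bsupp Yx] := eqVneq (b x) 0; first by rewrite !mulr0.
    by rewrite indicE mem_set// mul1r.
  - by apply: measurable_funM => //; exact: measurable_indic.
  - by move=> x; rewrite mulr_ge0// indicE ler0n.
have mgphi : measurable_fun [set: X] (fun x => g (phi x)).
  exact: (measurableT_comp mg mphi).
have mbd (q : X -> R) : measurable_fun [set: X] q -> measurable_fun [set: X]
    (fun x => \1_Y (phi x) * q (phi x) * normc (w x) ^+ 2).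
  move=> mq; apply: measurable_funM; last exact: measurable_normc_sqr.
  have mYq : measurable_fun [set: X] (fun x => \1_Y x * q x).
    by apply: measurable_funM => //; exact: measurable_indic.
  exact: (measurableT_comp mYq mphi).
have mg2 : measurable_fun [set: X] (fun x => g x ^+ 2) by exact: measurable_funX.
have gI : (\int[mu]_x (g x)%:E < +oo)%E.
  have := gE (cst 1) (measurable_cst _) (fun=> ler01).
  under eq_integral do rewrite /= mul1r.
  by under [RHS]eq_integral do rewrite /= mul1r; move=> <-.
have g2I : (\int[mu]_x (g x ^+ 2)%:E < +oo)%E.
  under eq_integral do rewrite expr2.
  rewrite -gE//; apply: (@le_lt_trans _ _ (\int[mu]_x
      (M * (\1_Y (phi x) * g (phi x) * normc (w x) ^+ 2))%:E)%E).
    apply: le_integral_EFin.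
    - exact: measurable_funM.
    - by apply: measurable_funM; [exact: measurable_cst|exact: mbd].
    - by move=> x; rewrite mulr_ge0.
    by move=> x; rewrite gY mulrCA ler_wpM2l.
  rewrite integral_EFinZl//; last 2 first.
  - exact: mbd.
  - by move=> x; rewrite gY mulr_ge0// sqr_ge0.
  apply: lte_mul_pinfty; rewrite ?lee_fin//.
  by apply: le_lt_trans (bY g mg g_ge0) _; apply: lte_mul_pinfty; rewrite ?lee_fin.
exists g; split => //.
- exact: transfersP.
- apply/in_cL2; split; first exact: measurable_cfun_real.
  by under eq_integral do rewrite normc_real real_normK ?num_real//.
- apply/in_cL2; split.
    by apply: measurable_cfunM => //; exact: measurable_cfun_real.
  apply: (@le_lt_trans _ _ (c%:E * \int[mu]_x (g x ^+ 2)%:E)%E); last first.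
    by apply: lte_mul_pinfty; rewrite ?lee_fin.
  apply: le_trans (bY _ mg2 (fun x => sqr_ge0 _)).
  rewrite le_eqVlt; apply/orP; left; apply/eqP; apply: eq_integral => x _.
  congr EFin; rewrite normcM normc_real exprMn real_normK ?num_real// [RHS]mulrC.
  by congr (_ * _); rewrite expr2 [RHS]mulrA gY.
Qed.

Lemma exists_transfer (Y : set X) (M : R) (b : X -> R) :
  weight_bounded mu phi w Y -> 0 <= M -> measurable_fun [set: X] b ->
  (forall x, `|b x| <= M * normc (w x) ^+ 2) ->
  (forall x, b x != 0 -> Y (phi x)) ->
  mu.-integrable [set: X] (EFin \o b) ->
  exists g : X -> R, [/\ measurable_fun [set: X] g, transfers b g,
    (fun x => (g x)%:C : R[i]) \in cL2 mu &
    (fun x => w x * (g (phi x))%:C) \in cL2 mu].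
Proof.
move=> bY M0 mb bM bsupp bI.
have [b1 [b2 [[mb1 b1b] [mb2 b2b] bE]]] := measurable_pos_neg_parts mb.
have mnb : measurable_fun [set: X] (fun x => `|b x|) by exact: measurableT_comp.
have nbI : (\int[mu]_x (`|b x|)%:E < +oo)%E by move/integrableP : bI => [].
have part (b' : X -> R) : measurable_fun [set: X] b' ->
    (forall x, 0 <= b' x <= `|b x|) ->
    exists g : X -> R, [/\ measurable_fun [set: X] g, transfers b' g,
      (fun x => (g x)%:C : R[i]) \in cL2 mu &
      (fun x => w x * (g (phi x))%:C) \in cL2 mu].
  move=> mb' b'b.
  have b'0 x : 0 <= b' x by have /andP[] := b'b x.
  have b'le x : b' x <= `|b x| by have /andP[] := b'b x.
  apply: (exists_transfer_ge0 bY M0) => //.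
  - by move=> x; apply: le_trans (bM x).
  - move=> x b'x; apply: bsupp; apply: contra b'x => /eqP bx.
    by rewrite eq_le b'0 andbT -[leRHS](@normr0 _ R) -bx.
  - by apply: le_lt_trans nbI; exact: le_integral_EFin.
have [g1 [mg1 t1 g1L wg1L]] := part b1 mb1 b1b.
have [g2 [mg2 t2 g2L wg2L]] := part b2 mb2 b2b.
exists (fun x => g1 x - g2 x); split.
- exact: measurable_funB.
- move=> p mp pb.
  have pI (b' : X -> R) : measurable_fun [set: X] b' ->
      (forall x, 0 <= b' x <= `|b x|) ->
      mu.-integrable [set: X] (EFin \o (fun x => p (phi x) * b' x)).
    move=> mb' b'b; apply: le_integrable pb => //.
      apply/measurable_EFinP; apply: measurable_funM => //.
      exact: (measurableT_comp mp mphi).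
    move=> x _; rewrite /= lee_fin !normrM ler_wpM2l//.
    by have /andP[b'0 b'le] := b'b x; rewrite ger0_norm.
  have [i1 e1] := t1 p mp (pI _ mb1 b1b).
  have [i2 e2] := t2 p mp (pI _ mb2 b2b).
  have -> : (fun x => p (phi x) * b x) =
      (fun x => p (phi x) * b1 x - p (phi x) * b2 x).
    by apply/funext => x; rewrite bE mulrBr.
  have -> : (fun x => p x * (g1 x - g2 x)) = (fun x => p x * g1 x - p x * g2 x).
    by apply/funext => x; rewrite mulrBr.
  split; first exact: (integrableB _ i1 i2).
  by rewrite !RintegralB// ?e1 ?e2//; exact: pI.
- have -> : (fun x => (g1 x - g2 x)%:C : R[i]) =
      (fun x => (g1 x)%:C) - (fun x => (g2 x)%:C).
    by apply/funext => x; rewrite rmorphB.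
  exact: rpredB.
- have -> : (fun x => w x * (g1 (phi x) - g2 (phi x))%:C) =
      (fun x => w x * (g1 (phi x))%:C) - (fun x => w x * (g2 (phi x))%:C).
    by apply/funext => x; rewrite rmorphB mulrBr.
  exact: rpredB.
Qed.

End transfer.

(** * The domain of the product of the operator and its adjoint *)

Section adjoint.
Context d (X : measurableType d) (R : realType).
Variable mu : {sigma_finite_measure set X -> \bar R}.
Local Open Scope quotient_scope.

Variables (phi : X -> X) (w : X -> R[i]).
Hypothesis mphi : measurable_fun [set: X] phi.
Hypothesis mw : measurable_cfun w.
Hypothesis ac : pushforward (weighted_measure mu w) phi `<< mu.

Lemma wcomp_op_pi (f : cL2fun mu) (wf : (fun x => w x * f (phi x)) \in cL2 mu) :
  wcomp_op mu phi w (\pi_(L2 mu) f, \pi_(L2 mu) (CL2fun wf)).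
Proof.
have ff := ae_eq_wcomp mphi mw ac (L2_reprP f).
have /in_cL2[mwf wfI] := wf.
have mwf' : measurable_cfun (fun x => w x * L2_repr (\pi_(L2 mu) f) (phi x)).
  apply: measurable_cfunM => //.
  by apply: measurable_cfun_comp => //; exact: L2_measurable.
split => /=; last first.
  by apply: filterS2 ff (L2_reprP (CL2fun wf)) => x -> // ->.
apply/in_cL2; split => //.
by rewrite -cL2norm_ltyE// (ae_eq_cL2norm mwf' mwf ff) cL2norm_ltyE.
Qed.

(** The adjoint sends [f] to the conjugate of the density of the image under
[phi] of w f^* mu. The bound |f| <= M |w| dominates w f^* by M |w|^2, which the
bound over [Y] controls; the bound |w| <= M |f| makes it integrable. *)
Lemma op_dom_wcomp_adjoint (Y : set X) (M : R) (f : cL2fun mu) :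
  weight_bounded mu phi w Y -> 0 <= M ->
  (forall x, f x != 0 -> w x != 0 -> [/\ Y (phi x),
    normc (f x) <= M * normc (w x) & normc (w x) <= M * normc (f x)]) ->
  op_dom (op_mul (wcomp_op mu phi w) (adjoint (wcomp_op mu phi w)))
    (\pi_(L2 mu) f).
Proof.
move=> bY M0 fw.
have [mf fI] := (in_cL2 mu f).1 (valP f).
pose b x : R[i] := w x * conjc (f x).
have mb : measurable_cfun b by apply: measurable_cfunM => //; exact: measurable_conjc.
have bE x : normc (b x) = normc (w x) * normc (f x).
  by rewrite normcM normc_conjc.
have b0 x : b x != 0 -> f x != 0 /\ w x != 0.
  by move=> bx; split; apply: contra bx => /eqP x0; rewrite /b x0 ?conjc0 ?mulr0 ?mul0r.
have bw x : normc (b x) <= M * normc (w x) ^+ 2.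
  have [->|/b0[fx wx]] := eqVneq (b x) 0.
    by rewrite normc0 mulr_ge0// sqr_ge0.
  have [_ fle _] := fw x fx wx.
  by rewrite bE expr2 mulrCA ler_wpM2l ?normc_ge0.
have bf x : normc (b x) <= M * normc (f x) ^+ 2.
  have [->|/b0[fx wx]] := eqVneq (b x) 0.
    by rewrite normc0 mulr_ge0// sqr_ge0.
  have [_ _ wle] := fw x fx wx.
  by rewrite bE expr2 mulrA ler_wpM2r ?normc_ge0.
have part (a : X -> R) : measurable_fun [set: X] a ->
    (forall x, `|a x| <= normc (b x)) ->
    exists g : X -> R, [/\ measurable_fun [set: X] g, transfers mu phi a g,
      (fun x => (g x)%:C : R[i]) \in cL2 mu &
      (fun x => w x * (g (phi x))%:C) \in cL2 mu].
  move=> ma ab; apply: (exists_transfer mphi mw ac bY M0) => //.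
  - by move=> x; exact: le_trans (ab x) (bw x).
  - move=> x ax; have /b0[fx wx] : b x != 0.
      rewrite -normc_gt0; apply: lt_le_trans (ab x).
      by rewrite normr_gt0.
    by have [] := fw x fx wx.
  apply: (@le_integrable_EFin _ _ _ _ _ (fun x => M * normc (f x) ^+ 2)) => //.
    by move=> x; exact: le_trans (ab x) (bf x).
  apply: integrable_EFin_ge0.
  - by apply: measurable_funM; [exact: measurable_cst|exact: measurable_normc_sqr].
  - by move=> x; rewrite mulr_ge0// sqr_ge0.
  rewrite integral_EFinZl//; last 2 first.
  - exact: measurable_normc_sqr.
  - by move=> x; exact: sqr_ge0.
  by apply: lte_mul_pinfty; rewrite ?lee_fin.
have [g1 [mg1 t1 g1L wg1L]] := part _ mb.1 (fun x => Re_le_normc (b x)).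
have [g2 [mg2 t2 g2L wg2L]] := part _ mb.2 (fun x => Im_le_normc (b x)).
pose g x : R[i] := (g1 x) +i* (- g2 x).
have gL : g \in cL2 mu.
  have -> : g = (fun x => (g1 x)%:C) + (- 'i) *: (fun x => (g2 x)%:C).
    apply/funext => x; rewrite /g !fctE; apply/eqP; rewrite eq_complex/=.
    by apply/andP; split; apply/eqP; ring.
  by apply: rpredD => //; exact: rpredZ.
have wgL : (fun x => w x * g (phi x)) \in cL2 mu.
  have -> : (fun x => w x * g (phi x)) = (fun x => w x * (g1 (phi x))%:C) +
      (- 'i) *: (fun x => w x * (g2 (phi x))%:C).
    apply/funext => x; rewrite /g !fctE; case: (w x) => ? ?.
    apply/eqP; rewrite eq_complex/=.
    by apply/andP; split; apply/eqP; ring.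
  by apply: rpredD => //; exact: rpredZ.
exists (\pi_(L2 mu) (CL2fun wgL)); exists (\pi_(L2 mu) (CL2fun gL)); last first.
  exact: (@wcomp_op_pi (CL2fun gL) wgL).
move=> p p' [/= /in_cL2[mwp wpI] p'E].
have [mp1 mp2] := L2_measurable p.
have mg : measurable_cfun g by have [] := (in_cL2 mu g).1 gL.
rewrite (L2_inner_ae mwp mf p'E (L2_reprP f)).
rewrite (L2_inner_ae (L2_measurable p) mg _ (L2_reprP (CL2fun gL))); last exact: aeW.
(* The integrand is at most |w (p o phi)| |f|, a product of two
   square-integrable functions. *)
have prodI (q a : X -> R) : measurable_fun [set: X] q ->
    measurable_fun [set: X] a ->
    (forall x, `|q x| <= normc (p x)) -> (forall x, `|a x| <= normc (b x)) ->
    mu.-integrable [set: X] (EFin \o (fun x => q (phi x) * a x)).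
  move=> mq ma qp ab.
  apply: (@le_integrable_EFin _ _ _ _ _
      (fun x => normc (w x * p (phi x)) ^+ 2 + normc (f x) ^+ 2)).
  - by apply: measurable_funM => //; exact: (measurableT_comp mq mphi).
  - move=> x; rewrite normrM.
    apply: (@le_trans _ _ (normc (w x * p (phi x)) * normc (f x))).
      rewrite normcM mulrAC -bE mulrC.
      by apply: ler_pM => //; rewrite ?normr_ge0.
    have := sqr_ge0 (normc (w x * p (phi x)) - normc (f x)).
    have := normc_ge0 (w x * p (phi x)); have := normc_ge0 (f x).
    by move=> *; nra.
  - apply: (@integrableD _ _ _ mu setT measurableT
      (EFin \o (fun x => normc (w x * p (phi x)) ^+ 2))
      (EFin \o (fun x => normc (f x) ^+ 2))).
      apply: integrable_EFin_ge0 => //; first exact: measurable_normc_sqr.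
      by move=> x; exact: sqr_ge0.
    apply: integrable_EFin_ge0 => //; first exact: measurable_normc_sqr.
    by move=> x; exact: sqr_ge0.
have Rp x := Re_le_normc (p x); have Ip x := Im_le_normc (p x).
have Rb x := Re_le_normc (b x); have Ib x := Im_le_normc (b x).
have I11 := prodI _ _ mp1 mb.1 Rp Rb.
have I12 := prodI _ _ mp1 mb.2 Rp Ib.
have I21 := prodI _ _ mp2 mb.1 Ip Rb.
have I22 := prodI _ _ mp2 mb.2 Ip Ib.
have [J11 e11] := t1 _ mp1 I11; have [J12 e12] := t2 _ mp1 I12.
have [J21 e21] := t1 _ mp2 I21; have [J22 e22] := t2 _ mp2 I22.
congr Complex.
- transitivity (\int[mu]_x (complex.Re (p (phi x)) * complex.Re (b x) -
      complex.Im (p (phi x)) * complex.Im (b x))).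
    apply: eq_Rintegral => x _; rewrite /b.
    by case: (w x) (L2_repr p (phi x)) (cL2_val f x) => ? ? [? ?] [? ?] /=; ring.
  rewrite RintegralB// e11 e22 -RintegralB//.
  by apply: eq_Rintegral => x _; rewrite /g; case: (L2_repr p x) => ? ? /=; ring.
- transitivity (\int[mu]_x (complex.Re (p (phi x)) * complex.Im (b x) +
      complex.Im (p (phi x)) * complex.Re (b x))).
    apply: eq_Rintegral => x _; rewrite /b.
    by case: (w x) (L2_repr p (phi x)) (cL2_val f x) => ? ? [? ?] [? ?] /=; ring.
  rewrite RintegralD// e12 e21 -RintegralD//.
  by apply: eq_Rintegral => x _; rewrite /g; case: (L2_repr p x) => ? ? /=; ring.
Qed.

End adjoint.

(** * Truncation and density *)

Section exhaustion.
Context d (X : measurableType d) (R : realType).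
Variable mu : {sigma_finite_measure set X -> \bar R}.
Local Open Scope quotient_scope.

(** Truncating [f] to [T n] puts it in the domain of the product. The sets are
obtained from the growing bounded sets of [phi] and from a growing constant
comparing [f] and [w], so they contain every point of the support eventually;
stating this for a single operator allows two exhaustions to be intersected. *)
Lemma wcomp_adjoint_exhaustion (phi : X -> X) (w f : X -> R[i]) :
  measurable_fun [set: X] phi -> measurable_cfun w ->
  pushforward (weighted_measure mu w) phi `<< mu ->
  densely_defined (wcomp_op mu phi w) -> measurable_cfun f ->
  exists T : nat -> set X, [/\ forall n, measurable (T n),
    forall x, f x != 0 -> \forall n \near \oo, T n x &
    forall n (g : cL2fun mu), (forall x, g x != 0 -> T n x /\ g x = f x) ->
      op_dom (op_mul (wcomp_op mu phi w) (adjoint (wcomp_op mu phi w)))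
        (\pi_(L2 mu) g)].
Proof.
move=> mphi mw ac dd mf.
have [Y bY YT] := sigma_weight_boundedT mphi mw ac dd.
pose Z n := \big[setU/set0]_(k < n) Y k.
have bZ n : weight_bounded mu phi w (Z n).
  exact: weight_bounded_bigsetU.
pose T n : set X := ~` [set x | w x != 0] `|` (phi @^-1` Z n `&`
  ([set x | normc (f x) <= n%:R * normc (w x)] `&`
   [set x | normc (w x) <= n%:R * normc (f x)])).
have mnM (n : nat) (h : X -> R[i]) : measurable_cfun h ->
    measurable_fun [set: X] (fun x => n%:R * normc (h x)).
  by move=> mh; apply: measurable_funM; [exact: measurable_cst|exact: measurable_normc].
exists T; split=> [n|x fx|n g gT].
- apply: measurableU; first exact/measurableC/measurable_support.
  apply: measurableI.
    by rewrite -[X in measurable X]setTI; apply: mphi => //; have [] := bZ n.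
  apply: measurableI; rewrite -[X in measurable X]setTI.
    by apply: measurable_fun_le => //; [exact: measurable_normc|exact: mnM].
  by apply: measurable_fun_le => //; [exact: measurable_normc|exact: mnM].
- have [wx0|wx] := eqVneq (w x) 0.
    by apply: nearW => n; left; rewrite /= wx0 eqxx.
  have [k _ Yk] := YT (phi x) I.
  have fx0 : 0 < normc (f x) by rewrite normc_gt0.
  have wx0 : 0 < normc (w x) by rewrite normc_gt0.
  have H (a b : R) : 0 < a -> 0 < b -> \forall n \near \oo, a <= n%:R * b.
    move=> a0 b0; near=> n; rewrite -ler_pdivrMr//; near: n.
    exact: nbhs_infty_ger.
  near=> n; right; split; last first.
    by split => /=; near: n; exact: H.
  rewrite /Z /= -bigcup_mkord; exists k => //=.
  by near: n; exact: nbhs_infty_gt.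
- apply: (op_dom_wcomp_adjoint mphi mw ac (bZ n) (ler0n _ n)) => x gx wx.
  by have [[/(_ wx)//|[Zx [/= fw wf]]] ->] := gT x gx.
Unshelve. all: by end_near. Qed.

End exhaustion.

Theorem proposition33 (d : measure_display) (X : measurableType d)
    (R : realType) (mu : {sigma_finite_measure set X -> \bar R})
    (phi1 phi2 : X -> X) (w1 w2 : X -> R[i])
    (mphi1 : measurable_fun [set: X] phi1)
    (mphi2 : measurable_fun [set: X] phi2)
    (mw1 : measurable_cfun w1) (mw2 : measurable_cfun w2)
    (ac1 : pushforward (weighted_measure mu w1) phi1 `<< mu)
    (ac2 : pushforward (weighted_measure mu w2) phi2 `<< mu)
    (dd1 : densely_defined (wcomp_op mu phi1 w1))
    (dd2 : densely_defined (wcomp_op mu phi2 w2)) :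
  densely_defined
    (op_add
      (op_mul (wcomp_op mu phi1 w1) (adjoint (wcomp_op mu phi1 w1)))
      (op_mul (wcomp_op mu phi2 w2) (adjoint (wcomp_op mu phi2 w2)))).
Proof.
apply: dense_L2 => f e e0.
have [mf fI] := (in_cL2 mu f).1 (valP f).
have [T1 [mT1 fT1 dom1]] := wcomp_adjoint_exhaustion mphi1 mw1 ac1 dd1 mf.
have [T2 [mT2 fT2 dom2]] := wcomp_adjoint_exhaustion mphi2 mw2 ac2 dd2 mf.
pose T n := T1 n `&` T2 n.
have mT n : measurable (T n) by exact: measurableI.
pose h n x : R[i] := (\1_(T n) x)%:C * f x.
have hE n x : h n x = if x \in T n then f x else 0.
  by rewrite /h indicE; case: ifP => _; rewrite ?mul1r ?mul0r.
have mh n : measurable_cfun (h n).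
  by apply: measurable_cfunM => //; exact/measurable_cfun_real/measurable_indic.
have hL n : h n \in cL2 mu.
  apply/in_cL2; split => //; apply: le_lt_trans fI; apply: le_integral_EFin.
  - exact: measurable_normc_sqr.
  - exact: measurable_normc_sqr.
  - by move=> x; exact: sqr_ge0.
  - by move=> x; rewrite hE; case: ifP => // _; rewrite normc0 expr0n sqr_ge0.
(* Dominated convergence, with |f|^2 as the dominating function. *)
have cvg_h : (\int[mu]_x (normc (f x - h n x) ^+ 2)%:E @[n --> \oo] --> 0)%E.
  have mfh n := measurable_normc_sqr (measurable_cfunB mf (mh n)).
  have [] := @dominated_convergence _ _ _ mu setT measurableT
    (fun n x => (normc (f x - h n x) ^+ 2)%:E) (cst 0%E)
    (fun x => (normc (f x) ^+ 2)%:E).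
  - by move=> n; apply/measurable_EFinP.
  - exact: measurable_cst.
  - apply: aeW => x _; apply: cvg_near_cst.
    have [fx|fx] := eqVneq (f x) 0.
      by apply: nearW => n; rewrite /h fx mulr0 subr0 normc0 expr0n.
    apply: filterS2 (fT1 x fx) (fT2 x fx) => n T1x T2x.
    by rewrite hE mem_set ?subrr ?normc0 ?expr0n.
  - apply: integrable_EFin_ge0 => //; first exact: measurable_normc_sqr.
    by move=> x; exact: sqr_ge0.
  - apply: aeW => x n _; rewrite /= lee_fin ger0_norm ?sqr_ge0// hE.
    by case: ifP => _; rewrite ?subr0// subrr normc0 expr0n sqr_ge0.
  by move=> _ _; rewrite integral0.
have e20 : (0 < (e ^+ 2)%:E)%E by rewrite lte_fin exprn_gt0.
have [n _ /(_ n (leqnn n)) /= hn] := cvg_h _ (open_ereal_lt' e20).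
exists (CL2fun (hL n)) => //.
have hT (x : X) : CL2fun (hL n) x != 0 -> T n x /\ CL2fun (hL n) x = f x.
  by rewrite /= hE; case: ifP => [/[!inE]//|_]; rewrite eqxx.
have [x /hT[[]]//|k1 k1P] := dom1 n (CL2fun (hL n)).
have [x /hT[[]]//|k2 k2P] := dom2 n (CL2fun (hL n)).
by exists (k1 + k2); exists k1, k2.
Qed.
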